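(* Let $q\geq 2$ be an integer and let $X$ be a $(q+1)$-regular tree with set of oriented edges $\mathrm{E}$. Set $$C=\frac{8(q+1)^2}{(q-1)^2}\quad\text{ and }\quad K=\frac{16q^2(2q+1)}{(q-1)^3(q+1)}.$$ Then for all vertices $x,y$ of $X$, $$4\,d(x,y)\leq\Vert\mathcal{P}\bar{B}(x,y)\Vert_{\ell^2(\mathrm{E})}^2\leq C\,d(x,y)+K,$$ where $\bar B(x,y)$ is the class modulo constants of the Busemann cocycle $B(x,y)$ and $\mathcal{P}$ is the Poisson transform.
   Context: Let $q\ge 2$ and let $X$ be a $(q+1)$-regular tree, with metric $d$ giving each edge length 1. $\mathrm{E}$ is the set of oriented edges (each geometric edge gives two elements $e,\bar e\in \mathrm{E}$, opposite orientations); $o(e)$ and $t(e)$ are the origin and target of $e$. $\partial X$ is the visual boundary (asymptotic classes of geodesic rays) with the cone topology, which is compact. For vertices $x,z$, the shadow $\Omega_x(z)\subset\partial X$ is the set of $\xi$ such that $z$ lies on the geodesic ray from $x$ to $\xi$. Busemann cocycle: for vertices $x,y$ and $\xi\in\partial X$, $B(x,y)(\xi)=\lim_{z\to\xi} \big(d(y,z)-d(x,z)\big)$; this is a continuous (indeed locally constant) function on $\partial X$. $\bar B(x,y)$ is its class in $C(\partial X)/\mathbf{C}$ (continuous functions modulo constants). Visual measures: for a vertex $x$, $\nu_x$ is the unique Borel probability measure on $\partial X$ with $\nu_x(\Omega_x(z))=\frac{1}{q^{n-1}(q+1)}$ for all vertices $z$ with $d(x,z)=n$, $n\geq 1$. For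 $e\in \mathrm{E}$ put $\Omega_e^+=\Omega_{t(e)}(o(e))$ and $\Omega_e^-=\Omega_{o(e)}(t(e))$, so $\partial X=\Omega_e^+\sqcup\Omega_e^-$. Let $\nu_e^+=\frac{q+1}{q}\,\nu_{o(e)}|_{\Omega_e^+}$ and $\nu_e^-=(q+1)\,\nu_{o(e)}|_{\Omega_e^-}$ (both probability measures), and $\nu_e=\nu_e^+-\nu_e^-$. Poisson transform: for $\phi\in C(\partial X)$, $\mathcal{P}\phi\colon \mathrm{E}\to\mathbf{C}$ is $\mathcal{P}\phi(e)=\int_{\partial X}\phi\, d\nu_e$. It vanishes on constants, hence is well defined on $C(\partial X)/\mathbf{C}$; so $\mathcal{P}\bar B(x,y)=\mathcal{P}B(x,y)$. The $\ell^2(\mathrm{E})$-norm squared is the sum of squares over all oriented edges. *)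

(* Defs.v *)
From HB Require Import structures.
From mathcomp Require Import all_boot all_order all_algebra.
From mathcomp Require Import zify finmap.
From mathcomp Require Import all_classical all_reals all_analysis.
From mathcomp.real_closed Require Import complex.

Set Implicit Arguments.
Unset Strict Implicit.
Unset Printing Implicit Defensive.

Import Order.TTheory GRing.Theory Num.Theory.
Import numFieldNormedType.Exports.

Local Open Scope quotient_scope.
Local Open Scope classical_set_scope.

(* The bound 1 < q is part of the structure so that the boundary is nonempty  *)
(* and can carry a canonical measurable structure (which must be pointed).    *)
Record regular_tree (q : nat) := RegularTree {
  vertex :> choiceType;
  adj : rel vertex;
  adj_sym : symmetric adj;
  adj_irr : irreflexive adj;
  tree_inhabited : inhabited vertex;
  tree_connected : forall x y, exists2 p, path adj x p & last x p = y;
  tree_acyclic : forall c : seq vertex, ucycle adj c -> (size c <= 2)%N;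
  tree_regular : forall x, exists s : seq vertex,
    [/\ uniq s, size s = q.+1 & forall y, (y \in s) = adj x y];
  tree_degree : (1 < q)%N }.

Section Combinatorics.
Context {q : nat} {X : regular_tree q}.
Implicit Types x y z o s : X.

Let reachable x y : exists n,
  `[< exists p : seq X, [/\ path (@adj q X) x p, last x p = y & size p = n] >].
Proof.
have [p xp pE] := tree_connected x y.
by exists (size p); apply/asboolP; exists p.
Qed.

Definition dist x y : nat := ex_minn (reachable x y).

Lemma dist_le x y p : path (@adj q X) x p -> last x p = y -> (dist x y <= size p)%N.
Proof.
move=> xp pE; rewrite /dist; case: ex_minnP => n _; apply.
by apply/asboolP; exists p.
Qed.

Lemma dist_path x y :
  exists p : seq X, [/\ path (@adj q X) x p, last x p = y & size p = dist x y].
Proof. by rewrite /dist; case: ex_minnP => n /asboolP. Qed.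

Lemma distxx x : dist x x = 0%N.
Proof. by apply/eqP; rewrite -leqn0; apply: (@dist_le x x [::]). Qed.

Lemma dist_triangle x y z : (dist x z <= dist x y + dist y z)%N.
Proof.
have [p [xp pE <-]] := dist_path x y; have [r [yr rE <-]] := dist_path y z.
rewrite -size_cat; apply: dist_le; first by rewrite cat_path xp pE.
by rewrite last_cat pE.
Qed.

Lemma rev_adj_path x p : path (@adj q X) x p ->
  path (@adj q X) (last x p) (rev (belast x p)).
Proof.
move=> xp; rewrite rev_path; apply: sub_path xp => a b.
by rewrite adj_sym.
Qed.

Lemma dist_sym x y : dist x y = dist y x.
Proof.
wlog suff le : x y / (dist x y <= dist y x)%N.
  by apply/eqP; rewrite eqn_leq !le.
have [p [yp pE <-]] := dist_path y x.
have := rev_adj_path yp; rewrite pE => /dist_le.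
rewrite size_rev size_belast; apply.
case: p yp pE => [|a p] _ //= _.
by rewrite rev_cons last_rcons.
Qed.

Lemma path_unique x p p' :
  path (@adj q X) x p -> uniq (x :: p) ->
  path (@adj q X) x p' -> uniq (x :: p') ->
  last x p = last x p' -> p = p'.
Proof.
elim: p x p' => [|a p IH] x p'.
  case: p' => // b p' _ _ _ /= /andP[xp' _] E.
  by rewrite E mem_last in xp'.
case: p' => [|b p'] xp up xp' up' E.
  move: up => /= /andP[xp0 _]; have /= E' : last a p = x by exact: E.
  by rewrite -E' mem_last in xp0.
have [ab|ab] := eqVneq a b.
  subst b; congr (_ :: _); apply: (IH a).
  - by case/andP: xp.
  - by case/andP: up.
  - by case/andP: xp'.
  - by case/andP: up'.
  - exact: E.
have hp : has (mem (a :: p)) (b :: p').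
  apply/hasP; exists (last b p'); first exact: mem_last.
  by move: E => /= <-; exact: mem_last.
have hd : head x (b :: p') = b by [].
have hd' : head x (a :: p) = a by [].
move: (b :: p') hp xp' up' E hd => P' hP.
case: (split_find hP) => w s1 s2 wP /hasPn ns1 xP' uP' E hd.
move: (a :: p) xp up wP ns1 E hd' {hP} => P xP uP wP ns1 E hd'.
case/path.splitP: wP xP uP ns1 E hd' => t1 t2 xP uP ns1 E hd'.
have xt : path (@adj q X) x (rcons t1 w) by move: xP; rewrite cat_path => /andP[].
have xs : path (@adj q X) x (rcons s1 w) by move: xP'; rewrite cat_path => /andP[].
have : ucycle (@adj q X) (x :: t1 ++ w :: rev s1).
  apply/andP; split.
    rewrite /= -cats1 -catA /= -cat_rcons cat_path xt last_rcons /=.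
    have := rev_adj_path xs; rewrite last_rcons belast_rcons rev_cons.
    by rewrite -cats1.
  move: uP uP'; rewrite !cat_rcons /= => /andP[xn u1] /andP[xn' u2].
  move: xn xn'; rewrite !mem_cat !inE !negb_or.
  move=> /and3P[xt1 xw _] /and3P[xs1 _ _].
  rewrite xt1 xw mem_rev xs1 /=.
  move: u1 u2; rewrite !cat_uniq /= rev_uniq => /and3P[-> nt /andP[_ _]] /and3P[us1 ns _].
  rewrite us1 /= mem_rev andbT.
  move: ns => /norP[-> _]; rewrite andbT.
  move: nt => /norP[wt1 _]; rewrite negb_or wt1 /=.
  apply/hasPn => v; rewrite mem_rev => /ns1.
  by rewrite inE mem_cat mem_rcons inE; apply: contra => /= ->; rewrite orbT.
move=> /tree_acyclic; rewrite /= size_cat /= size_rev => sz.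
move: sz; rewrite addnS !ltnS leqn0 addn_eq0 => /andP[/nilP t10 /nilP s10].
by move: hd hd' ab; rewrite t10 s10 /= => -> ->; rewrite eqxx.
Qed.

Lemma geodesic_uniq x p : path (@adj q X) x p -> size p = dist x (last x p) ->
  uniq (x :: p).
Proof.
move=> xp sp; have [p' [xp' up' sub pl]] : exists p', [/\ path (@adj q X) x p',
    uniq (x :: p'), {subset p' <= p} & last x p' = last x p].
  by case: (shortenP xp) => p' ? ? ?; exists p'.
apply: (leq_size_uniq up'); last by rewrite /= ltnS sp dist_le.
by move=> v; rewrite !inE => /orP[->//|/sub ->]; rewrite orbT.
Qed.

Lemma uniq_geodesic x p : path (@adj q X) x p -> uniq (x :: p) ->
  size p = dist x (last x p).
Proof.
move=> xp up; have [g [xg gE sg]] := dist_path x (last x p).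
rewrite -sg; congr size; apply: (path_unique xp up xg) => //.
by apply: geodesic_uniq => //; rewrite gE.
Qed.

(* Removing s separates the vertices beyond s from those closer to o than s.  *)
Lemma separation o s x z : dist o z = (dist o s + dist s z)%N ->
  (dist o x < dist o s)%N -> dist x z = (dist x s + dist s z)%N.
Proof.
move=> oz ox.
have [p [op pE sp]] := dist_path o x; have [g [xg gE sg]] := dist_path x z.
have sNop : s \notin o :: p.
  apply/negP => sop; have := ox; rewrite ltnNge => /negP; apply.
  move: sop; rewrite inE => /orP[/eqP->|]; first by rewrite distxx.
  move=> sp'; rewrite -sp; case/path.splitP: sp' op => p1 p2.
  rewrite cat_path => /andP[op1 _]; rewrite size_cat.
  by apply: leq_trans (leq_addr _ _); apply: dist_le op1 _; rewrite last_rcons.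
have [sxg|sNxg] := boolP (s \in x :: g).
  apply/eqP; rewrite eqn_leq dist_triangle /= -sg.
  move: sxg; rewrite inE => /orP[/eqP->|sg'].
    by rewrite distxx add0n sg.
  case/path.splitP: sg' xg gE => g1 g2.
  rewrite cat_path last_rcons last_cat last_rcons size_cat => /andP[xg1 sg2] gE.
  by apply: leq_add; apply: dist_le => //; rewrite last_rcons.
have [c1 [oc1 c1E sc1]] := dist_path o s; have [c2 [sc2 c2E szc2]] := dist_path s z.
have oc : path (@adj q X) o (c1 ++ c2) by rewrite cat_path oc1 c1E.
have ocl : last o (c1 ++ c2) = z by rewrite last_cat c1E.
have uc : uniq (o :: c1 ++ c2).
  by apply: geodesic_uniq => //; rewrite ocl size_cat sc1 szc2.
have opg : path (@adj q X) o (p ++ g) by rewrite cat_path op pE.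
have opgl : last o (p ++ g) = z by rewrite last_cat pE.
have [u [ou uu usub ul]] : exists u, [/\ path (@adj q X) o u, uniq (o :: u),
    {subset u <= p ++ g} & last o u = z].
  by rewrite -opgl; case: (shortenP opg) => u ? ? ?; exists u.
have cu : c1 ++ c2 = u by apply: (path_unique oc uc ou uu); rewrite ocl ul.
have : s \in o :: u.
  have := mem_last o c1; rewrite c1E -cu !inE mem_cat => /orP[->//|->].
  by rewrite orbT.
rewrite inE => /orP[/eqP so|/usub].
  by move: sNop; rewrite so mem_head.
move: sNop sNxg; rewrite mem_cat !inE !negb_or => /andP[_ /negbTE ->].
by move=> /andP[_ /negbTE ->].
Qed.

End Combinatorics.

Section Boundary.
Context {q : nat} (X : regular_tree q).
Implicit Types x y z : X.

Record ray := Ray {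
  ray_fun :> nat -> X;
  ray_geodesic : forall m n, dist (ray_fun m) (ray_fun (m + n)) = n }.

HB.instance Definition _ := gen_eqMixin ray.
HB.instance Definition _ := gen_choiceMixin ray.

Definition asymptotic : rel ray :=
  fun r s => `[< exists M, forall n, (dist (r n) (s n) <= M)%N >].

Let asymptotic_refl : reflexive asymptotic.
Proof. by move=> r; apply/asboolP; exists 0%N => n; rewrite distxx. Qed.

Let asymptotic_sym : symmetric asymptotic.
Proof.
by move=> r s; apply/asboolP/asboolP => -[M h]; exists M => n; rewrite dist_sym.
Qed.

Let asymptotic_trans : transitive asymptotic.
Proof.
move=> s r t /asboolP[M rs] /asboolP[N st]; apply/asboolP; exists (M + N)%N => n.
exact: leq_trans (dist_triangle _ (s n) _) (leq_add (rs n) (st n)).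
Qed.

Canonical asymptotic_equiv :=
  EquivRel asymptotic asymptotic_refl asymptotic_sym asymptotic_trans.

Definition boundary := {eq_quot asymptotic_equiv}.
HB.instance Definition _ := Choice.on boundary.
HB.instance Definition _ := EqQuotient.on boundary.

Definition endpoint (r : ray) : boundary := \pi_boundary r.

Definition shadow (x z : X) : set boundary :=
  [set xi | exists2 r : ray, r 0%N = x /\ endpoint r = xi & exists n, r n = z].

HB.instance Definition _ := isSubBaseTopological.Build boundary
  [set A | exists x z, A = shadow x z] id.

(* Vertices tending to xi in the cone topology: as x ranges over the vertices *)
(* and p over the ray from x to xi, the sets of vertices z such that p lies   *)
(* between x and z are the traces on X of a base of neighbourhoods of xi.     *)
Definition towards (xi : boundary) : set_system X :=
  filter_from [set p : X * X | shadow p.1 p.2 xi]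
    (fun p => [set z | dist p.1 z = (dist p.1 p.2 + dist p.2 z)%N]).

Lemma dist_ray (r : ray) m n : (m <= n)%N -> dist (r m) (r n) = (n - m)%N.
Proof. by move=> mn; rewrite -{1}(subnKC mn) ray_geodesic. Qed.

Lemma endpointP (r s : ray) : endpoint r = endpoint s ->
  exists M, forall n, (dist (r n) (s n) <= M)%N.
Proof. by move=> rs; have /eqquotP /asboolP := rs. Qed.

Lemma asymptotic_beyond (r s : ray) n : endpoint r = endpoint s ->
  exists M0, forall M, (M0 <= M)%N -> forall z,
    dist (s 0%N) z = (M + dist (s M) z)%N -> dist (r 0%N) z = (n + dist (r n) z)%N.
Proof.
move=> /endpointP[K rsK]; exists (n + K + dist (s 0%N) (r 0%N)).+1 => M hM z hz.
have sM : dist (s 0%N) (s M) = M by rewrite dist_ray // subn0.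
have h1 : dist (r 0%N) z = (dist (r 0%N) (s M) + dist (s M) z)%N.
  by apply: (@separation _ _ (s 0%N)); rewrite sM //; lia.
have h2 : dist (s M) (r 0%N) = (dist (s M) (r n) + dist (r n) (r 0%N))%N.
  apply: (@separation _ _ (r M)).
    rewrite ![dist (r M) _]dist_sym ![dist (r n) (r 0%N)]dist_sym.
    by rewrite !dist_ray //; lia.
  rewrite [dist (r M) (r n)]dist_sym dist_ray; last by lia.
  by have := rsK M; lia.
have rn : dist (r n) (r 0%N) = n by rewrite dist_sym dist_ray // subn0.
have t1 := dist_triangle (r n) (s M) z.
have t2 := dist_triangle (r 0%N) (r n) z.
by move: h1 h2 t1 t2; rewrite ![dist (s M) (r _)]dist_sym [dist (r 0%N) (r n)]dist_sym rn; lia.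
Qed.

Global Instance towards_filter xi : ProperFilter (towards xi).
Proof.
have [r <-] : exists r, endpoint r = xi by exists (repr xi); exact: reprK.
apply: filter_from_proper; last by move=> [x p] /= _; exists p => /=; rewrite distxx addn0.
apply: filter_from_filter.
  by exists (r 0%N, r 0%N) => /=; exists r => //; exists 0%N.
move=> [x p] [x' p'] /= [s [<- sxi] [n <-]] [t [<- txi] [m <-]].
have st : endpoint s = endpoint t by rewrite sxi txi.
have [M0 HM] := asymptotic_beyond n st.
exists (t 0%N, t (M0 + m)%N) => /=; first by exists t => //; exists (M0 + m)%N.
move=> z /=; rewrite !dist_ray // !subn0 => hz; split.
  by apply: (HM _ _ _ hz); exact: leq_addr.
have t1 := dist_triangle (t m) (t (M0 + m)%N) z.
have t2 := dist_triangle (t 0%N) (t m) z.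
by move: t1 t2; rewrite !dist_ray ?leq_addl //; lia.
Qed.

Lemma open_shadow x z : open (shadow x z).
Proof.
pose S := [set A : set boundary | exists x z, A = shadow x z].
exists [set shadow x z].
  move=> A ->; exists [fset (shadow x z : set boundary)]%fset.
    by move=> B /fset1P ->; rewrite inE; exists x, z.
  rewrite predeqE => xi; split; first by move=> /(_ (shadow x z)); apply; exact/fset1P.
  by move=> h B /fset1P ->.
rewrite predeqE => xi; split; first by case=> A ->.
by move=> h; exists (shadow x z).
Qed.

Lemma neighbour_avoiding (a b : X) : exists c, adj b c && (c != a).
Proof.
have [s [us ss sE]] := tree_regular b; have q1 := tree_degree X.
have : has (predC1 a) s.
  apply/negPn/negP => /hasPn h.
  have : (size s <= size [:: a])%N.
    apply: uniq_leq_size => // v /h /=.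
    by rewrite negbK inE.
  by rewrite ss /=; lia.
by case/hasP => c; rewrite sE => bc /= ca; exists c; rewrite bc.
Qed.

Lemma adj_path (r : nat -> X) : (forall n, adj (r n) (r n.+1)) ->
  forall m n, path (@adj q X) (r m) [seq r i | i <- iota m.+1 n].
Proof. by move=> radj m n; elim: n m => //= n IH m; rewrite radj; exact: IH. Qed.

Lemma nonbacktracking_neq (r : nat -> X) :
  (forall n, adj (r n) (r n.+1)) -> (forall n, r n.+2 != r n) ->
  forall j m, r (m + j.+1)%N != r m.
Proof.
move=> radj rnb; elim/ltn_ind => j IH m; apply/negP => /eqP rmj.
have : ucycle (@adj q X) [seq r i | i <- iota m j.+1].
  apply/andP; split.
    have := adj_path radj m j.+1.
    by rewrite -[X in iota _ X]addn1 iotaD map_cat /= addSnnS rmj cats1.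
  rewrite map_inj_in_uniq ?iota_uniq // => i i'; rewrite !mem_iota.
  wlog ii : i i' / (i <= i')%N.
    by move=> W *; case/orP: (leq_total i i') => ?; [apply: W|symmetry; apply: W].
  move=> mi mi' E; apply/eqP; rewrite eqn_leq ii /= leqNgt; apply/negP => lt.
  have lt' : (i' - i.+1 < j)%N by lia.
  have := IH _ lt' i.
  have -> : (i + (i' - i.+1).+1)%N = i' by lia.
  by rewrite E eqxx.
move=> /tree_acyclic; rewrite size_map size_iota => j2.
case: j j2 rmj {IH} => [|[|//]] _ E.
  by have := radj m; rewrite -addn1 E adj_irr.
by have := rnb m; rewrite -E addn2 eqxx.
Qed.

Lemma ray_exists : inhabited ray.
Proof.
have [x0] := tree_inhabited X.
pose next (ab : X * X) := (ab.2, projT1 (cid (neighbour_avoiding ab.1 ab.2))).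
have nextP ab : adj ab.2 (next ab).2 && ((next ab).2 != ab.1).
  by rewrite /next /=; case: cid.
pose r n := (iter n next (x0, x0)).2.
have radj n : adj (r n) (r n.+1) by have /andP[] := nextP (iter n next (x0, x0)).
have rnb n : r n.+2 != r n.
  by have /andP[_] := nextP (iter n.+1 next (x0, x0)).
have neq := nonbacktracking_neq radj rnb.
suff rg m n : dist (r m) (r (m + n)%N) = n by exists; exact: (Ray rg).
have pE : last (r m) [seq r i | i <- iota m.+1 n] = r (m + n)%N.
  case: n => [|n]; first by rewrite addn0.
  by rewrite -[X in iota _ X]addn1 iotaD map_cat last_cat /= addSnnS.
have up : uniq (r m :: [seq r i | i <- iota m.+1 n]).
  rewrite -[_ :: _]/[seq r i | i <- iota m n.+1].
  rewrite map_inj_in_uniq ?iota_uniq // => i i' _ _.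
  wlog ii : i i' / (i <= i')%N.
    by move=> W *; case/orP: (leq_total i i') => ?; [apply: W|symmetry; apply: W].
  move=> E; apply/eqP; rewrite eqn_leq ii /= leqNgt; apply/negP => lt.
  have := neq (i' - i.+1)%N i.
  have -> : (i + (i' - i.+1).+1)%N = i' by lia.
  by rewrite E eqxx.
by rewrite -pE -(uniq_geodesic (adj_path radj m n) up) size_map size_iota.
Qed.

Let boundary_point : boundary :=
  endpoint (projT1 (cid (let: inhabits r := ray_exists in
                         ex_intro (fun=> True) r I))).

HB.instance Definition _ := isPointed.Build boundary boundary_point.

Definition borel_boundary := g_sigma_algebraType (@open boundary).

Lemma measurable_shadow x z : measurable (shadow x z : set borel_boundary).
Proof. by apply: sub_sigma_algebra; exact: open_shadow. Qed.

End Boundary.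

Section Edges.
Context {q : nat} (X : regular_tree q).

Definition edge := {e : X * X | adj e.1 e.2}.

Definition origin (e : edge) : X := (val e).1.
Definition target (e : edge) : X := (val e).2.

Definition shadow_plus (e : edge) : set (boundary X) :=
  shadow (target e) (origin e).
Definition shadow_minus (e : edge) : set (boundary X) :=
  shadow (origin e) (target e).

Lemma measurable_shadow_plus e :
  measurable (shadow_plus e : set (borel_boundary X)).
Proof. exact: measurable_shadow. Qed.

Lemma measurable_shadow_minus e :
  measurable (shadow_minus e : set (borel_boundary X)).
Proof. exact: measurable_shadow. Qed.

End Edges.

Local Open Scope ring_scope.
Local Open Scope complex_scope.

Section ContinuousFunctions.
Context (R : realType) {q : nat} (X : regular_tree q).

(* Viewed as a numClosedFieldType, R[i] carries the topology of its modulus.  *)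
Definition CX := continuousType (boundary X) (R[i] : numClosedFieldType).

Definition eq_mod_cst : rel CX :=
  fun phi psi => `[< exists c : R[i], forall xi, phi xi = psi xi + c >].

Let eq_mod_cst_refl : reflexive eq_mod_cst.
Proof. by move=> phi; apply/asboolP; exists 0 => xi; rewrite addr0. Qed.

Let eq_mod_cst_sym : symmetric eq_mod_cst.
Proof.
by move=> phi psi; apply/asboolP/asboolP => -[c h]; exists (- c) => xi;
  rewrite h addrK.
Qed.

Let eq_mod_cst_trans : transitive eq_mod_cst.
Proof.
move=> psi phi chi /asboolP[c h] /asboolP[c' h']; apply/asboolP.
by exists (c' + c) => xi; rewrite h h' addrA.
Qed.

Canonical eq_mod_cst_equiv :=
  EquivRel eq_mod_cst eq_mod_cst_refl eq_mod_cst_sym eq_mod_cst_trans.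

Definition CX_mod_cst := {eq_quot eq_mod_cst_equiv}.

End ContinuousFunctions.

Section Busemann.
Context (R : realType) {q : nat} {X : regular_tree q}.
Implicit Types x y : X.

Definition busemann x y (xi : boundary X) : R :=
  lim (((dist y z)%:R - (dist x z)%:R : R) @[z --> towards xi]).

Lemma busemann_shadow x y o s (eta : boundary X) :
  (dist o x < dist o s)%N -> (dist o y < dist o s)%N -> shadow o s eta ->
  busemann x y eta = (dist y s)%:R - (dist x s)%:R.
Proof.
move=> ox oy etaos; apply: lim_near_cst; first exact: Rhausdorff.
exists (o, s) => //= z /= oz.
by rewrite (separation oz ox) (separation oz oy) !natrD opprD addrACA subrr addr0.
Qed.

Definition busemannC x y (xi : boundary X) : (R[i] : numClosedFieldType) :=
  (busemann x y xi)%:C.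

Lemma busemannC_continuous x y : continuous (busemannC x y).
Proof.
move=> xi; have [r rxi] : exists r, endpoint r = xi by exists (repr xi); exact: reprK.
pose N := (dist (r 0%N) x + dist (r 0%N) y).+1.
have rN : dist (r 0%N) (r N) = N by rewrite dist_ray // subn0.
have xiN : shadow (r 0%N) (r N) xi by exists r => //; exists N.
move=> W /nbhs_singleton Wxi.
have : nbhs xi (shadow (r 0%N) (r N)).
  by apply: open_nbhs_nbhs; split=> //; exact: open_shadow.
apply: filterS => eta etaN.
suff E : busemannC x y eta = busemannC x y xi by rewrite /= E.
by rewrite /busemannC !(@busemann_shadow x y (r 0%N) (r N)) // rN ltnS ?leq_addr ?leq_addl.
Qed.

Definition busemannCX x y : CX R X := mkcts (@busemannC_continuous x y).

Definition busemann_class x y : CX_mod_cst R X :=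
  \pi_(CX_mod_cst R X) (busemannCX x y).

End Busemann.

Section PoissonTransform.
Context {R : realType} {q : nat} {X : regular_tree q}.

Definition is_visual_measure (x : X) (mu : set (borel_boundary X) -> \bar R) :=
  forall z n, dist x z = n -> (1 <= n)%N ->
    mu (shadow x z) = ((q%:R ^+ n.-1 * q.+1%:R)^-1)%:E.

Variable nu : X -> probability (borel_boundary X) R.

Definition nu_plus (e : edge X) :=
  mscale (q.+1%:R / q%:R)%:nng
    (mrestr (nu (origin e)) (measurable_shadow_plus e)).

Definition nu_minus (e : edge X) :=
  mscale (q.+1%:R)%:nng
    (mrestr (nu (origin e)) (measurable_shadow_minus e)).

Definition complex_integral (mu : {measure set (borel_boundary X) -> \bar R})
    (phi : boundary X -> R[i]) : R[i] :=
  (\int[mu]_(xi in setT) complex.Re (phi xi))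
    +i* (\int[mu]_(xi in setT) complex.Im (phi xi)).

(* Integration against the signed measure nu_plus e - nu_minus e.             *)
Definition poisson (phi : CX R X) (e : edge X) : R[i] :=
  complex_integral (nu_plus e) phi - complex_integral (nu_minus e) phi.

(* When each nu x is the visual measure at x, nu_plus e and nu_minus e have    *)
(* total mass 1, so poisson does not depend on the representative.            *)
Definition poisson_class (u : CX_mod_cst R X) : edge X -> R[i] :=
  poisson (repr u).

End PoissonTransform.

Definition l2norm_sq {R : realType} {E : choiceType} (f : E -> R[i]) : \bar R :=
  \esum_(e in [set: E]) (Normc.normc (f e) ^+ 2)%:E.

(* Main.v *)
Require Import Defs.
From mathcomp Require Import all_boot all_order all_algebra.
From mathcomp Require Import zify lra ring finmap.
From mathcomp Require Import all_classical all_reals all_analysis.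
From mathcomp.real_closed Require Import complex.

(* Cut the geodesic from x to y into edges f_1, ..., f_n. By the cocycle
   relation B(x, y) is the sum of the B(f_i), and B(f_i) is, up to sign, 1 minus
   twice the indicator of a shadow seen from the origin of a given edge e. Hence
   P B(f_i)(e) = +-2 q^-D, with D the number of steps from e to f_i and the sign
   telling whether e and f_i are coherently oriented.
   On the edges of the geodesic all terms have the same sign, so the value lies
   between 2 and 2 (q + 1) / (q - 1) in absolute value; this gives the lower
   bound and the linear part of the upper bound. On an edge at distance m from
   the geodesic, hanging off its k-th vertex, the terms on the two sides of that
   vertex cancel up to 2 q^-m (q^-(n-k) - q^-k) / (q - 1); there are at most
   ((q - 1) + [k = 0] + [k = n]) q^m such edges, whence the constant K. *)

Set Implicit Arguments.
Unset Strict Implicit.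
Unset Printing Implicit Defensive.

Import Order.TTheory GRing.Theory Num.Theory.

(** * Distances in a tree and projection to a segment *)

Section TreeDistance.
Context {q : nat} {X : regular_tree q}.
Implicit Types a b c o s t u w x y z : X.

Lemma dist0 x y : dist x y = 0%N -> x = y.
Proof.
by have [p [_ <- <-]] := dist_path x y => /eqP /nilP ->.
Qed.

Lemma adj_dist a b : adj a b -> dist a b = 1%N.
Proof.
move=> ab; apply/eqP; rewrite eqn_leq lt0n; apply/andP; split.
  by apply: (@dist_le _ _ _ _ [:: b]) => //=; rewrite ab.
by apply/eqP => /dist0 abE; rewrite abE adj_irr in ab.
Qed.

Lemma dist1_adj a b : dist a b = 1%N -> adj a b.
Proof.
have [p [ap pE <-]] := dist_path a b.
by case: p ap pE => [|c [|]] //= /andP[ac _] <-.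
Qed.

Lemma adj_dist_lip z a b : adj a b -> (dist z b <= (dist z a).+1)%N.
Proof. by move=> /adj_dist ab; have := dist_triangle z a b; lia. Qed.

(** Appending [b] to a geodesic from [z] to [a] repeats no vertex, and in a tree a path without
    repetition is a geodesic. *)
Lemma adj_dist_up z a b : adj a b -> (dist z a <= dist z b)%N ->
  dist z b = (dist z a).+1.
Proof.
move=> ab le; have [p [zp pE sp]] := dist_path z a.
have zpb : path (@adj q X) z (rcons p b) by rewrite rcons_path zp pE.
have up : uniq (z :: p) by apply: geodesic_uniq; rewrite ?pE.
suff ub : uniq (z :: rcons p b).
  by rewrite -sp -(size_rcons p b) (uniq_geodesic zpb ub) last_rcons.
rewrite -rcons_cons rcons_uniq up andbT inE negb_or; apply/andP; split.
  apply/eqP => bz; move: le; rewrite bz distxx leqn0 => /eqP /dist0 za.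
  by rewrite bz -za adj_irr in ab.
apply/negP => bp; move: sp pE zp; case/path.splitP: bp => p1 p2.
rewrite size_cat last_cat cat_path last_rcons size_rcons => sp pE /andP[zp1 bp2].
have := dist_le zp1 (last_rcons _ _ _); rewrite size_rcons => le1.
case: p2 sp pE bp2 => [|c p2] /=; last by lia.
by move=> _ ba; rewrite ba adj_irr in ab.
Qed.

Lemma adj_distP z a b : adj a b ->
  dist z b = (dist z a).+1 \/ dist z a = (dist z b).+1.
Proof.
move=> ab; case: (leqP (dist z a) (dist z b)) => [le|lt].
  by left; exact: adj_dist_up.
by right; apply: adj_dist_up (ltnW lt); rewrite adj_sym.
Qed.

(** Otherwise [a] and [c] would both come last before [b] on geodesics from [z] to [b], against
    uniqueness of geodesics. *)
Lemma dist_turn z a b c : adj a b -> adj b c -> a != c ->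
  dist z b = (dist z a).+1 -> dist z c = (dist z b).+1.
Proof.
move=> ab bc ac zb; case: (adj_distP z bc) => // zc.
have [p [zp pE sp]] := dist_path z a; have [p' [zp' pE' sp']] := dist_path z c.
have pb : path (@adj q X) z (rcons p b) by rewrite rcons_path zp pE.
have pb' : path (@adj q X) z (rcons p' b) by rewrite rcons_path zp' pE' adj_sym.
have : rcons p b = rcons p' b.
  apply: (@path_unique _ _ z) => //; rewrite ?last_rcons //;
    by apply: geodesic_uniq => //; rewrite last_rcons size_rcons; lia.
by move=> /rcons_inj[pp]; move: ac; rewrite -pE -pE' pp eqxx.
Qed.

Lemma closer_neighbour z w m : dist z w = m.+1 ->
  exists2 c, adj z c & dist c w = m.
Proof.
move=> zw; have [p [zp pE]] := dist_path z w; rewrite zw.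
case: p zp pE => //= c p /andP[zc cp] pE [sp].
exists c => //; have := dist_le cp pE; have := dist_triangle z c w.
by rewrite (adj_dist zc); lia.
Qed.

(** The edge points away from [o] and towards [s]. Walking on from [b] to [s] never backtracks, so
    by [dist_turn] every step recedes from [o]. *)
Lemma dist_across o a b s : adj a b ->
  dist o b = (dist o a).+1 -> dist s a = (dist s b).+1 ->
  dist o s = (dist o b + dist b s)%N.
Proof.
move=> ab ob; rewrite (dist_sym s b).
move e : (dist b s) => m; elim: m a b ab ob e => [|m IH] a b ab ob bs sa.
  by rewrite -(dist0 bs) addn0.
have [c bc cs] := closer_neighbour bs.
have ac : a != c by apply/eqP => ac; move: sa; rewrite ac dist_sym cs; lia.
have oc := dist_turn ab bc ac ob.
rewrite (IH b c bc oc cs) ?oc; last by rewrite dist_sym bs.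
by lia.
Qed.

(* For m > 0 the two edges would lie on a circuit of length 2m + 2. *)
Lemma parallel_edges a b c d m : adj a b -> adj c d ->
  dist a c = m -> dist b d = m -> dist a d = m.+1 -> dist b c = m.+1 -> m = 0%N.
Proof.
move=> ab cd ac bd ad bc.
have := @dist_across a c d b cd; rewrite ac ad bc bd (dist_sym d) bd (adj_dist ab).
by lia.
Qed.

(* v k is the projection of z to the segment and m its distance to z; as
   subtraction is truncated, (i - k) + (k - i) is the distance from i to k. *)
Lemma dist_segment (v : nat -> X) n z :
  (forall i, (i < n)%N -> adj (v i) (v i.+1)) ->
  (forall i, (i.+1 < n)%N -> v i != v i.+2) ->
  exists k m, (k <= n)%N /\
    forall i, (i <= n)%N -> dist z (v i) = (m + (i - k) + (k - i))%N.
Proof.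
elim: n => [|n IH] va vn.
  by exists 0%N, (dist z (v 0%N)); split=> // i; rewrite leqn0 => /eqP->; lia.
have [i lt|i lt|k [m [kn hk]]] := IH; [by apply: va; lia|by apply: vn; lia|].
have an := va n (ltnSn n).
have [up|down] := adj_distP z an.
  exists k, m; split; first by lia.
  move=> i; rewrite leq_eqVlt => /orP[/eqP->|]; last by move=> ?; apply: hk; lia.
  by rewrite up hk //; lia.
(* If [k < n], the step before already recedes from [z], and [dist_turn] makes the last one recede
   too. So [z] projects to [v n], and the projection moves on to [v n.+1], at distance [m.-1]. *)
have kn' : k = n.
  apply/eqP; rewrite eqn_leq kn leqNgt /=; apply/negP => lt.
  case: n {IH} va vn kn hk an down lt => // n va vn kn hk an down lt.
  have := @dist_turn z _ _ _ (va n (ltnW (ltnSn _))) an (vn n (ltnSn _)).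
  by have := hk n; have := hk n.+1; lia.
subst k; exists n.+1, (m.-1)%N; split=> // i.
have := hk n (leqnn n); rewrite leq_eqVlt => hn /orP[/eqP->|]; first by lia.
by move=> ?; rewrite hk; lia.
Qed.

End TreeDistance.

(** * Classifying and counting the edges around a segment *)

Section EdgesAroundSegment.
Context {q : nat} {X : regular_tree q}.
Implicit Types a b c o s t u w x y z : X.

Definition neighbours x : seq X := projT1 (cid (tree_regular x)).

Lemma neighbours_uniq x : uniq (neighbours x).
Proof. by rewrite /neighbours; case: cid => s []. Qed.

Lemma size_neighbours x : size (neighbours x) = q.+1.
Proof. by rewrite /neighbours; case: cid => s []. Qed.

Lemma mem_neighbours x y : (y \in neighbours x) = adj x y.
Proof. by rewrite /neighbours; case: cid => s [] /= _ _ ->. Qed.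

Lemma count_neighbours_neq c p : adj p c -> count (predC1 p) (neighbours c) = q.
Proof.
move=> pc; have := count_predC (pred1 p) (neighbours c).
rewrite (count_uniq_mem _ (neighbours_uniq c)) mem_neighbours adj_sym pc.
by rewrite size_neighbours => -[].
Qed.

(* The edges at distance m from p, oriented away from p, in the branches at p
   whose first vertex satisfies P. *)
Fixpoint branch_edges (m : nat) (p : X) (P : pred X) : seq (X * X) :=
  if m is m'.+1
  then flatten [seq branch_edges m' c (predC1 p) | c <- neighbours p & P c]
  else [seq (p, c) | c <- neighbours p & P c].

(** [P] is asked only of first vertices on the way to [w]. In the induction it excludes the vertex
    just left, which is too far from [w] to be one. *)
Lemma mem_branch_edges m p (P : pred X) u w : adj u w ->
  dist p u = m -> dist p w = m.+1 ->
  (forall c, adj p c -> dist c w = m -> P c) -> (u, w) \in branch_edges m p P.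
Proof.
elim: m p P => [|m IH] p P uw pu pw hP /=.
  have pE := dist0 pu; rewrite -pE in uw; apply/mapP; exists w; last by rewrite pE.
  by rewrite mem_filter mem_neighbours uw hP ?distxx.
have [c pc cu] := closer_neighbour pu.
have cw : dist c w = m.+1.
  have := adj_dist_lip c uw; have := dist_triangle p c w; rewrite (adj_dist pc); lia.
apply/flattenP; exists (branch_edges m c (predC1 p)).
  by apply/mapP; exists c => //; rewrite mem_filter mem_neighbours pc hP.
apply: IH => // d _ dw; apply/eqP => dp.
by move: pw; rewrite -dp dw; lia.
Qed.

Lemma size_branch_edges m p (P : pred X) :
  size (branch_edges m p P) = (count P (neighbours p) * q ^ m)%N.
Proof.
elim: m p P => [|m IH] p P /=; first by rewrite size_map size_filter muln1.
rewrite size_flatten /shape -map_comp sumnE big_map.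
rewrite (eq_big_seq (fun=> (q ^ m.+1)%N)) /=.
  by rewrite big_const_seq count_predT size_filter iter_addn_0 mulnC.
move=> c; rewrite mem_filter mem_neighbours => /andP[_ pc] /=.
by rewrite IH count_neighbours_neq // expnS.
Qed.

Definition is_segment (v : nat -> X) n := forall i j, (i <= n)%N -> (j <= n)%N ->
  dist (v i) (v j) = ((i - j) + (j - i))%N.

Lemma geodesic_segment x y : exists v, [/\ is_segment v (dist x y),
  v 0%N = x & v (dist x y) = y].
Proof.
have [p [xp pE sp]] := dist_path x y.
exists (fun i => nth x (x :: p) i); split=> //; last first.
  by rewrite -sp -[RHS]pE -nth_last /=; case: p {xp pE sp}.
move=> i j; wlog ij : i j / (i <= j)%N.
  move=> W; case: (leqP i j) => [/W//|/ltnW ji] iN jN.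
  by rewrite dist_sym W // addnC.
move=> iN jN.
have step k : (k < dist x y)%N -> adj (nth x (x :: p) k) (nth x (x :: p) k.+1).
  by rewrite -sp => kp; have /pathP := xp; apply.
have lip h k : (h + k <= dist x y)%N ->
    (dist (nth x (x :: p) h) (nth x (x :: p) (h + k)) <= k)%N.
  elim: k => [|k IH] hk; first by rewrite addn0 distxx.
  rewrite addnS in hk *; have := IH (ltnW hk).
  by have := adj_dist_lip (nth x (x :: p) h) (step _ hk); lia.
have E : nth x (x :: p) (dist x y) = y.
  by rewrite -sp -[RHS]pE -nth_last /=; case: p {xp pE sp step lip}.
(* The bounds for the three pieces cut out by [i] and [j] add up to [dist x y], so the triangle
   inequality makes each of them sharp. *)
have := lip 0%N i; have := lip i (j - i)%N; have := lip j (dist x y - j)%N.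
rewrite !subnKC // add0n E => /(_ (leqnn _)) h1 /(_ jN) h2 /(_ iN) h3.
have := dist_triangle x (nth x (x :: p) i) y.
have := dist_triangle (nth x (x :: p) i) (nth x (x :: p) j) y.
by move: h1 h2 h3 => /=; lia.
Qed.

Section Segment.
Variables (v : nat -> X) (n : nat).
Hypothesis vn : is_segment v n.

Lemma segment_adj i : (i < n)%N -> adj (v i) (v i.+1).
Proof. by move=> lt; apply: dist1_adj; rewrite vn; lia. Qed.

Lemma segment_projection z : exists k m, (k <= n)%N /\
    forall i, (i <= n)%N -> dist z (v i) = (m + (i - k) + (k - i))%N.
Proof.
apply: dist_segment => [|i lt]; first exact: segment_adj.
by apply/eqP => E; have := @vn i i.+2; rewrite -E distxx; lia.
Qed.

(* (u, w) is oriented away from the segment; u projects to v k, at distance m. *)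
Definition outward k m u w := forall i, (i <= n)%N ->
  dist u (v i) = (m + (i - k) + (k - i))%N /\
  dist w (v i) = (m.+1 + (i - k) + (k - i))%N.

(** If both endpoints project to the same vertex, the edge points outward in one of its
    orientations. If not, the projections are adjacent and at equal distances, and [parallel_edges]
    makes that distance 0. *)
Lemma edge_position o t : adj o t ->
  (exists2 j, (j < n)%N & (o, t) = (v j, v j.+1) \/ (t, o) = (v j, v j.+1)) \/
  (exists k m, (k <= n)%N /\ (outward k m o t \/ outward k m t o)).
Proof.
move=> ot.
have [k [m [kn hk]]] := segment_projection o.
have [l [m' [ln hl]]] := segment_projection t.
have dif i : (i <= n)%N -> dist t (v i) = (dist o (v i)).+1 \/
    dist o (v i) = (dist t (v i)).+1.
  by move=> lei; rewrite ![dist _ (v i)]dist_sym; exact: adj_distP.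
have [kl|kl] := eqVneq k l.
  subst l; right; exists k, (minn m m'); split=> //.
  have [|] := dif k kn; rewrite hk // hl // => E; [left|right];
    by move=> i lei; rewrite hk // hl //; split; lia.
have /= mm : m = m' /\ (l = k.+1 \/ k = l.+1).
  by have := dif k kn; have := dif l ln; rewrite !hk // !hl //; lia.
case: mm => mm lk; subst m'; left.
wlog lk' : o t k l ot kn ln hk hl dif kl lk / l = k.+1.
  move=> W; case: (lk) => E; first exact: (W o t k l).
  have [| | | | |i lei| | | |j jn H] // := W t o l k; rewrite 1?adj_sym // 1?eq_sym //.
  - by have [->|->] := dif i lei; [right|left].
  - by case: lk; [right|left].
  - by exists j => //; case: H => ->; [right|left].
subst l => {lk dif kl}; exists k => //; left.
have m0 : m = 0%N.
  by apply: (parallel_edges ot (segment_adj ln)); rewrite ?hk ?hl; lia.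
subst m; congr (_, _); apply: dist0; rewrite ?hk ?hl //; lia.
Qed.

(** The guards matter at the ends: [0.-1] is [0], and [v] is unconstrained beyond [n]. *)
Definition leaves_segment k : pred X := fun c =>
  ~~ ((0 < k)%N && (c == v k.-1)) && ~~ ((k < n)%N && (c == v k.+1)).

Lemma count_leaves_segment k : (k <= n)%N ->
  (count (leaves_segment k) (neighbours (v k)) <= q.-1 + (k == 0%N) + (k == n))%N.
Proof.
move=> kn; set N := neighbours (v k).
pose P1 := [pred c | (0 < k)%N && (c == v k.-1)].
pose P2 := [pred c | (k < n)%N && (c == v k.+1)].
have cN : count (leaves_segment k) N = (q.+1 - count (predU P1 P2) N)%N.
  rewrite -(size_neighbours (v k)) -(count_predC (predU P1 P2)) addKn.
  by apply: eq_count => c /=; rewrite /leaves_segment negb_or.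
have c1 : count P1 N = (0 < k)%N :> nat.
  case: (posnP k) => [k0|k0].
    by rewrite (eq_count (_ : _ =1 pred0)) ?count_pred0 // => c /=; rewrite k0.
  rewrite (eq_count (_ : _ =1 pred1 (v k.-1))); last by move=> c /=; rewrite k0.
  rewrite count_uniq_mem ?neighbours_uniq // mem_neighbours adj_sym.
  by have := @segment_adj k.-1; rewrite prednK // => ->.
have c2 : count P2 N = (k < n)%N :> nat.
  case: (ltnP k n) => [lt|ge].
    rewrite (eq_count (_ : _ =1 pred1 (v k.+1))); last by move=> c /=; rewrite lt.
    by rewrite count_uniq_mem ?neighbours_uniq // mem_neighbours segment_adj.
  by rewrite (eq_count (_ : _ =1 pred0)) ?count_pred0 // => c /=; rewrite ltnNge ge.
(* The neighbours of [v k] along the segment are at distance 2 from each other, so no vertex is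
   excluded twice. *)
have c0 : count (predI P1 P2) N = 0%N.
  apply/eqP; rewrite -leqn0 leqNgt -has_count; apply/hasPn => c _ /=.
  apply/negP => /andP[/andP[k0 /eqP cE] /andP[lt /eqP cE']].
  by have := @vn k.-1 k.+1; rewrite -cE -cE' distxx; lia.
have := count_predUI P1 P2 N; rewrite c0 addn0 c1 c2 => cU.
rewrite cN cU; have := tree_degree X.
by case: (posnP k) => [->|k0]; case: (ltngtP k n) kn => //=; lia.
Qed.

Lemma outward_branch k m u w : (k <= n)%N -> adj u w -> outward k m u w ->
  (u, w) \in branch_edges m (v k) (leaves_segment k).
Proof.
move=> kn uw out; have [ku kw] := out k kn.
rewrite !subnn !addn0 dist_sym in ku; rewrite !subnn !addn0 dist_sym in kw.
apply: mem_branch_edges => // c _ cw; apply/andP; split.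
  apply/negP => /andP[k0 /eqP cE]; have [_] := out k.-1 (leq_trans (leq_pred _) kn).
  by rewrite dist_sym -cE cw; lia.
apply/negP => /andP[lt /eqP cE]; have [_] := out k.+1 lt.
by rewrite dist_sym -cE cw; lia.
Qed.

End Segment.
End EdgesAroundSegment.

(** * Shadows in terms of distances to far vertices of a ray *)

Section Rays.
Context {q : nat} {X : regular_tree q}.
Implicit Types (a b o s t z : X) (rho : ray X) (xi : boundary X).

(** The projection of [z] to the ray has index at most [dist z (rho 0)]; past it the distance grows
    by one at each step. *)
Lemma ray_eventually_leaves rho z N : (dist z (rho 0%N) <= N)%N ->
  dist z (rho N) = (dist z (rho (dist z (rho 0%N))) + (N - dist z (rho 0%N)))%N.
Proof.
set D := dist z (rho 0%N) => DN.
have [i _|i _|k [m [kN hk]]] := @dist_segment _ X rho N z.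
- by apply: dist1_adj; rewrite dist_ray //; lia.
- by apply/eqP => E; have := @dist_ray _ X rho i i.+2; rewrite -E distxx; lia.
have := hk 0%N (leq0n _); rewrite -/D => kD.
by rewrite !hk //; lia.
Qed.

(** The ray wanted follows a geodesic from [o] through [b] to [rho k], then [rho]. It is 1-Lipschitz
    and its [i]-th vertex is at distance [i] from [o], so it is geodesic. *)
Lemma ray_through rho o b k :
  (forall N, (k <= N)%N -> dist o (rho N) = (dist o (rho k) + (N - k))%N) ->
  dist o (rho k) = (dist o b + dist b (rho k))%N -> shadow o b (endpoint rho).
Proof.
move=> up ob; have [p1 [op1 pE1 sp1]] := dist_path o b.
have [p2 [bp2 pE2 sp2]] := dist_path b (rho k).
set D := dist o (rho k) in up ob.
pose p := p1 ++ p2.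
have sp : size p = D by rewrite size_cat sp1 sp2.
have op : path (@adj q X) o p by rewrite cat_path op1 pE1.
have pE : last o p = rho k by rewrite last_cat pE1.
pose r i := if (i < D)%N then nth o (o :: p) i else rho (k + (i - D))%N.
have nthD : nth o (o :: p) D = rho k by rewrite -sp -pE -nth_last /=; case: (p).
have rE i : (i <= D)%N -> r i = nth o (o :: p) i.
  by rewrite /r leq_eqVlt => /orP[/eqP->|->//]; rewrite ltnn subnn addn0 nthD.
have radj i : adj (r i) (r i.+1).
  case: (ltnP i D) => [lt|le].
    by rewrite !rE //; last exact: ltnW; have /pathP := op; apply; rewrite sp.
  rewrite /r ltnNge le /= ltnNge (leq_trans le) //=.
  by apply: dist1_adj; rewrite dist_ray; lia.
have rlip i j : (dist (r i) (r (i + j)) <= j)%N.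
  elim: j => [|j IH]; first by rewrite addn0 distxx.
  by rewrite addnS; have := adj_dist_lip (r i) (radj (i + j)%N); lia.
have r0 : r 0%N = o by rewrite rE.
have rD : r D = rho k by rewrite rE.
have ro i : dist o (r i) = i.
  case: (leqP D i) => [le|lt].
    by rewrite /r ltnNge le /= up; lia.
  have := rlip 0%N i; have := rlip i (D - i)%N; rewrite add0n r0 subnKC ?(ltnW lt) // rD.
  by have := dist_triangle o (r i) (rho k); rewrite -/D; lia.
have rg i j : dist (r i) (r (i + j)%N) = j.
  by have := rlip i j; have := dist_triangle o (r i) (r (i + j)%N); rewrite !ro; lia.
exists (Ray rg); first split=> //.
  (* From index [D] on both rays run along [rho], shifted by at most [D + k]; before that they are
     compared through [o] and [rho 0]. *)
  apply/eqquotP/asboolP; exists (D + D + k + dist o (rho 0%N))%N => i /=.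
  case: (leqP D i) => [le|lt].
    rewrite /r ltnNge le /=; case: (leqP (k + (i - D))%N i) => h.
      by rewrite dist_ray //; lia.
    by rewrite dist_sym dist_ray; lia.
  have := dist_triangle (r i) o (rho i); have := dist_triangle o (rho 0%N) (rho i).
  by rewrite (dist_sym (r i) o) ro (@dist_ray _ X rho 0 i) //; lia.
exists (dist o b); rewrite /= rE; last by rewrite ob leq_addr.
rewrite -sp1 -cat_cons nth_cat /= ltnS leqnn -[RHS]pE1 -nth_last.
by case: (p1).
Qed.

(** Any ray ending at the point decides membership, wherever it starts: one direction is
    [asymptotic_beyond], the other [ray_through]. *)
Lemma shadowP rho o b : exists M, forall N, (M <= N)%N ->
  (shadow o b (endpoint rho) <-> dist o (rho N) = (dist o b + dist b (rho N))%N).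
Proof.
set D := dist o (rho 0%N).
have back N : (D <= N)%N -> dist o (rho N) = (dist o b + dist b (rho N))%N ->
    shadow o b (endpoint rho).
  move=> DN; apply: ray_through => N' NN'.
  have := ray_eventually_leaves DN.
  by have := @ray_eventually_leaves rho o N' (leq_trans DN NN'); rewrite -/D; lia.
have [[r [r0 rE] [n rn]]|nsh] := pselect (shadow o b (endpoint rho)); last first.
  by exists D => N DN; split=> [/nsh//|]; exact: back.
have [M0 HM] := asymptotic_beyond n rE.
exists (maxn M0 D) => N; rewrite geq_max => /andP[MN DN]; split=> [_|]; last exact: back.
have := HM N MN (rho N); rewrite distxx addn0 dist_ray // subn0 => /(_ erefl).
by rewrite r0 rn => ->; rewrite -[in dist o b]rn -r0 dist_ray // subn0.
Qed.

Lemma endpointE xi : exists rho : ray X, endpoint rho = xi.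
Proof. by exists (repr xi); exact: reprK. Qed.

Lemma shadow_edge o t xi : adj o t -> shadow t o xi <-> ~ shadow o t xi.
Proof.
move=> ot; have [rho <-] := endpointE xi.
have [M1 h1] := shadowP rho o t; have [M2 h2] := shadowP rho t o.
rewrite (h1 (M1 + M2)%N) ?leq_addr // (h2 (M1 + M2)%N) ?leq_addl //.
set s := rho _; rewrite (dist_sym t o) (adj_dist ot) !add1n.
by have := adj_distP s ot; rewrite !(dist_sym s) => -[->|->]; split; lia.
Qed.

Lemma shadow_sub_minus o t b xi : adj o t -> (dist t b < dist o b)%N ->
  shadow o b xi -> shadow o t xi.
Proof.
move=> ot lt; have [rho <-] := endpointE xi.
have [M1 h1] := shadowP rho o t; have [M2 h2] := shadowP rho o b.
rewrite (h1 (M1 + M2)%N) ?leq_addr // (h2 (M1 + M2)%N) ?leq_addl //.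
set s := rho _ => obs; rewrite (adj_dist ot).
have := dist_triangle t b s; have := dist_triangle o t s; rewrite (adj_dist ot).
by lia.
Qed.

(** If a far vertex [s] of the ray were closer to [t], then [o] would lie between [b] and [s]; but
    [b] lies between [o] and [s], which forces [o = b]. *)
Lemma shadow_sub_plus o t b xi : adj o t -> o != b -> (dist o b <= dist t b)%N ->
  shadow o b xi -> shadow t o xi.
Proof.
move=> ot ob lt; have [rho <-] := endpointE xi.
have [M1 h1] := shadowP rho t o; have [M2 h2] := shadowP rho o b.
rewrite (h1 (M1 + M2)%N) ?leq_addr // (h2 (M1 + M2)%N) ?leq_addl //.
set s := rho _ => obs; rewrite (dist_sym t o) (adj_dist ot).
have bt : dist b t = (dist b o).+1.
  by apply: adj_dist_up => //; rewrite !(dist_sym b).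
have [|so] := adj_distP s ot; first by rewrite !(dist_sym s); lia.
have := dist_across ot bt so.
have : dist o b != 0%N by apply: contra_neq ob; exact: dist0.
have := dist_sym b o; have := dist_sym s o; have := dist_sym s t.
by lia.
Qed.

End Rays.

Local Open Scope classical_set_scope.
Local Open Scope ring_scope.

(** * Integrals of finite combinations of indicators *)

Section IntegralOfSteps.
Context d (T : measurableType d) (R : realType) (mu : {measure set T -> \bar R}).
Hypothesis mu1 : mu setT = 1%E.

Lemma mass1_integrable_indic (A : set T) : measurable A ->
  mu.-integrable setT (EFin \o \1_A).
Proof.
move=> mA; apply: measurable_bounded_integrable => //.
  by rewrite mu1 ltry.
exists 1; split=> // M M1 x _ /=; rewrite indicE.
by case: (x \in A); rewrite /= ?normr1 ?normr0; apply: ltW => //; apply: lt_trans M1.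
Qed.

Lemma Rintegral_steps (c : R) (a : nat -> R) (S : nat -> set T) n :
  (forall i, measurable (S i)) ->
  \int[mu]_x (c + \sum_(i < n) a i * \1_(S i) x) =
  c + \sum_(i < n) a i * fine (mu (S i)).
Proof.
move=> mS; suff [] : mu.-integrable setT
    (EFin \o (fun x => c + \sum_(i < n) a i * \1_(S i) x)) /\
    \int[mu]_x (c + \sum_(i < n) a i * \1_(S i) x) =
    c + \sum_(i < n) a i * fine (mu (S i)) by [].
have iS i : mu.-integrable setT (EFin \o (fun x => a i * \1_(S i) x)).
  exact: (integrableZl _ (a i) (mass1_integrable_indic (mS i))).
elim: n => [|n [IH1 IH2]].
  have -> : (fun x : T => c + \sum_(i < 0) a i * \1_(S i) x) = cst c.
    by apply/funext => x; rewrite big_ord0 addr0.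
  split.
    apply: measurable_bounded_integrable => //; first by rewrite mu1 ltry.
    exact: bounded_cst.
  by rewrite big_ord0 addr0 Rintegral_cst // mu1 mulr1.
have -> : (fun x : T => c + \sum_(i < n.+1) a i * \1_(S i) x) =
    (fun x : T => (c + \sum_(i < n) a i * \1_(S i) x) + a n * \1_(S n) x).
  by apply/funext => x; rewrite big_ord_recr /= addrA.
split; first exact: (integrableD _ IH1 (iS n)).
rewrite RintegralD // IH2 big_ord_recr /= addrA; congr (_ + _).
rewrite RintegralZl //; last exact: mass1_integrable_indic.
by rewrite /Rintegral integral_indic // setIT.
Qed.

End IntegralOfSteps.

(** * The Busemann cocycle as a sum over the edges of a path *)

Section BusemannSteps.
Context (R : realType) {q : nat} {X : regular_tree q}.
Implicit Types (a b o s t z : X) (rho : ray X) (xi : boundary X).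

Definition far o a b := if (dist o a < dist o b)%N then b else a.

Definition away o a b : R := if (dist o a < dist o b)%N then 1 else -1.

(** Far vertices of a ray ending in the shadow are reached from [o] across the edge, hence one step
    nearer to its far endpoint; otherwise they are one step nearer to the other endpoint. *)
Lemma dist_sub_step rho o a b : adj a b -> exists M, forall N, (M <= N)%N ->
  (dist b (rho N))%:R - (dist a (rho N))%:R =
  away o a b * (1 - 2 * \1_(shadow o (far o a b)) (endpoint rho)).
Proof.
wlog lt : a b / (dist o a < dist o b)%N.
  move=> W ab; have [lt|le] := ltnP (dist o a) (dist o b); first exact: W.
  have ba : adj b a by rewrite adj_sym.
  have up : dist o a = (dist o b).+1 by apply: adj_dist_up.
  have [|M hM] := W b a _ ba; first by rewrite up.
  exists M => N MN; rewrite -opprB hM // /away /far up ltnSn ltnNge leqnSn /=.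
  by rewrite mul1r mulN1r.
move=> ab; have ob := adj_dist_up ab (ltnW lt).
have [M hM] := shadowP rho o b; exists M => N MN; have {hM} := hM N MN.
rewrite /away /far lt mul1r indicE; set s := rho N.
have [sh|nsh] := pselect (shadow o b (endpoint rho)).
  move=> [/(_ sh) os _]; rewrite mem_set // mulr1.
  suff -> : dist a s = (dist b s).+1 by rewrite -natr1; ring.
  have := dist_triangle o a s; have := dist_triangle a b s.
  by rewrite (adj_dist ab); lia.
move=> [_ os]; rewrite memNset // mulr0 subr0.
suff -> : dist b s = (dist a s).+1 by rewrite -natr1; ring.
have := adj_distP s ab; rewrite !(dist_sym s) => -[//|sa]; exfalso; apply/nsh/os.
by apply: dist_across ab ob _; rewrite !(dist_sym s).
Qed.

(** All shadows are seen from one vertex [o], later the origin of the edge [e], since [nu_plus] and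
    [nu_minus] come from the visual measure there. *)
Lemma busemann_steps (v : nat -> X) n o xi :
  (forall i, (i < n)%N -> adj (v i) (v i.+1)) ->
  busemann R (v 0%N) (v n) xi = \sum_(i < n)
    away o (v i) (v i.+1) * (1 - 2 * \1_(shadow o (far o (v i) (v i.+1))) xi).
Proof.
have [rho <-] := endpointE xi => va.
have [M hM] : exists M, forall N, (M <= N)%N ->
    (dist (v n) (rho N))%:R - (dist (v 0%N) (rho N))%:R = \sum_(i < n)
    away o (v i) (v i.+1) * (1 - 2 * \1_(shadow o (far o (v i) (v i.+1))) (endpoint rho)).
  elim: n va => [|n IH] va; first by exists 0%N => N _; rewrite big_ord0 subrr.
  have [i lt|M1 h1] := IH; first by apply: va; exact: ltnW.
  have [M2 h2] := dist_sub_step rho o (va n (ltnSn n)).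
  exists (maxn M1 M2) => N; rewrite geq_max => /andP[N1 N2].
  by rewrite big_ord_recr /= -(h1 N N1) -(h2 N N2); ring.
(* With [rho N] farther from [rho 0] than both ends of the path, the limit defining [busemann] is
   its value at [rho N]. *)
pose N := (M + dist (rho 0%N) (v 0%N) + dist (rho 0%N) (v n)).+1.
rewrite -(hM N); last by rewrite /N; lia.
have rN : dist (rho 0%N) (rho N) = N by rewrite dist_ray // subn0.
apply: (@busemann_shadow R q X _ _ (rho 0%N)); rewrite ?rN /N; try lia.
by exists rho => //; exists N.
Qed.

End BusemannSteps.

(** * The Poisson transform of the Busemann cocycle *)

Section PoissonOfBusemann.
Context (R : realType) {q : nat} {X : regular_tree q}.
Variable nu : X -> probability (borel_boundary X) R.
Hypothesis hnu : forall x, is_visual_measure x (nu x).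

Let rq : R := q%:R^-1.

Let q0 : q%:R != 0 :> R.
Proof. by rewrite pnatr_eq0; have := tree_degree X; case: q. Qed.

Let q1 : q.+1%:R != 0 :> R.
Proof. by rewrite pnatr_eq0. Qed.

(* Half the Poisson transform of B(a, b) at the edge (o, t), for an edge (a, b).
   The exponent is the number of steps from one edge to the other, and the sign
   is + when the two edges are coherently oriented. *)
Definition poisson_step (o t a b : X) : R :=
  if (dist o a < dist o b)%N
  then if (dist t b < dist o b)%N then rq ^+ dist o a else - rq ^+ dist o b
  else if (dist t a < dist o a)%N then - rq ^+ dist o b else rq ^+ dist o a.

Lemma nu_shadow_edge (e : edge X) :
  nu (origin e) (shadow_minus e : set (borel_boundary X)) = (q.+1%:R^-1)%:E.
Proof. by rewrite (@hnu _ _ 1%N) ?expr0 ?mul1r // adj_dist //; exact: (valP e). Qed.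

Lemma shadow_plusE (e : edge X) : shadow_plus e = ~` shadow_minus e.
Proof.
by apply/seteqP; split=> xi; have [h1 h2] := shadow_edge xi (valP e).
Qed.

Lemma nu_minus_mass (e : edge X) : nu_minus nu e setT = 1%E.
Proof.
rewrite /nu_minus /= /mscale /= /mrestr setTI nu_shadow_edge -EFinM.
by rewrite /= divff.
Qed.

Lemma nu_plus_mass (e : edge X) : nu_plus nu e setT = 1%E.
Proof.
rewrite /nu_plus /= /mscale /= /mrestr setTI shadow_plusE.
rewrite probability_setC; last exact: measurable_shadow_minus.
rewrite nu_shadow_edge -EFinB -EFinM; congr (_%:E) => /=.
by rewrite -natr1; field; rewrite q0 natr1 q1.
Qed.

(** The shadow lies on one side of the edge, so only one measure charges it. With
    [dist o b = m + 1], its mass [1 / (q^m (q + 1))] is scaled by [q + 1] or by [(q + 1) / q]. *)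
Lemma nu_edge_shadow (e : edge X) b : origin e != b ->
  fine (nu_plus nu e (shadow (origin e) b)) -
  fine (nu_minus nu e (shadow (origin e) b)) =
  if (dist (target e) b < dist (origin e) b)%N then - rq ^+ (dist (origin e) b).-1
  else rq ^+ dist (origin e) b.
Proof.
set o := origin e; set t := target e => ob; have ot : adj o t := valP e.
have [m mE] : exists m, dist o b = m.+1.
  by case: (dist o b) (@dist0 _ _ o b) => [/(_ erefl) E|m _];
    [rewrite E eqxx in ob|exists m].
have nuS := hnu mE (ltn0Sn m).
rewrite /nu_plus /nu_minus /= /mscale /= /mrestr mE /=.
case: ifPn => [lt|]; last rewrite -leqNgt => le.
  have S : shadow o b `<=` shadow_minus e.
    by move=> xi; apply: shadow_sub_minus => //; rewrite mE.
  have -> : shadow o b `&` shadow_plus e = set0.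
    by rewrite shadow_plusE; apply/disjoints_subset; rewrite setCK.
  rewrite measure0 mule0 (setIidl S) nuS /= sub0r; congr (- _).
  by rewrite /rq exprVn; field; rewrite expf_neq0 ?q0 //= addrC natr1.
have S : shadow o b `<=` shadow_plus e.
  by move=> xi; apply: shadow_sub_plus => //; rewrite mE.
have -> : shadow o b `&` shadow_minus e = set0.
  by apply/disjoints_subset; rewrite -shadow_plusE.
rewrite measure0 mule0 (setIidl S) nuS /= subr0.
by rewrite /rq exprVn exprS; field; rewrite expf_neq0 ?q0 //= addrC natr1.
Qed.

(** The factor [- away] is half the coefficient of the indicator in [busemann_steps]. *)
Lemma nu_edge_step (e : edge X) a b : adj a b ->
  - away R (origin e) a b *
    (fine (nu_plus nu e (shadow (origin e) (far (origin e) a b))) -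
     fine (nu_minus nu e (shadow (origin e) (far (origin e) a b)))) =
  poisson_step (origin e) (target e) a b.
Proof.
move=> ab; rewrite /away /far /poisson_step; set o := origin e.
case: ifPn => [lt|]; last rewrite -leqNgt => le.
  have ob := adj_dist_up ab (ltnW lt).
  have oNb : o != b by apply/eqP => E; rewrite -E distxx in lt.
  by rewrite nu_edge_shadow // -/o ob /=; case: ifP => _; rewrite mulN1r ?opprK.
have oa : dist o a = (dist o b).+1 by apply: adj_dist_up le; rewrite adj_sym.
have oNa : o != a by apply/eqP => E; rewrite -E distxx in oa.
by rewrite nu_edge_shadow // -/o oa /=; case: ifP => _; rewrite opprK mul1r.
Qed.

Lemma poisson_busemann (v : nat -> X) n (e : edge X) :
  (forall i, (i < n)%N -> adj (v i) (v i.+1)) ->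
  poisson_class nu (busemann_class R (v 0%N) (v n)) e =
  (2 * \sum_(i < n) poisson_step (origin e) (target e) (v i) (v i.+1))%:C%C.
Proof.
move=> va; set o := origin e; set phi := repr (busemann_class R (v 0%N) (v n)).
(* The representative is only known up to a complex constant, which cancels because both measures
   have mass 1. *)
have [c phiE] : exists c, forall xi, phi xi = busemannC R (v 0%N) (v n) xi + c.
  have /eqquotP/asboolP [c hc] :
      \pi_(CX_mod_cst R X)%qT phi = \pi_(CX_mod_cst R X)%qT (busemannCX R (v 0%N) (v n)).
    by rewrite /phi reprK.
  by exists c.
pose S i := shadow o (far o (v i) (v i.+1)).
pose w i : R := - 2 * away R o (v i) (v i.+1).
pose k := complex.Re c + \sum_(i < n) away R o (v i) (v i.+1).
have reE : (fun xi : borel_boundary X => complex.Re (phi xi)) =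
    (fun xi => k + \sum_(i < n) w i * \1_(S i) xi).
  apply/funext => xi; rewrite phiE /busemannC (busemann_steps R o) //= /k.
  rewrite raddfD /= addrC -addrA -big_split /=; congr (_ + _).
  by apply: eq_bigr => i _; rewrite /w /S; ring.
have imE : (fun xi : borel_boundary X => complex.Im (phi xi)) = cst (complex.Im c).
  by apply/funext => xi; rewrite phiE raddfD /= add0r.
have mS i : measurable (S i : set (borel_boundary X)) by exact: measurable_shadow.
have intE (mu : {measure set (borel_boundary X) -> \bar R}) : mu setT = 1%E ->
    complex_integral mu phi =
    ((k + \sum_(i < n) w i * fine (mu (S i))) +i* complex.Im c)%C.
  move=> mu1; rewrite /complex_integral reE imE Rintegral_steps //.
  by rewrite Rintegral_cst // mu1 mulr1.
rewrite /poisson_class /poisson -/phi (intE _ (nu_plus_mass e)) (intE _ (nu_minus_mass e)).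
apply/eqP; rewrite eq_complex /= subrr eqxx andbT; apply/eqP.
rewrite opprD addrACA subrr add0r -sumrB mulr_sumr; apply: eq_bigr => i _.
by rewrite -nu_edge_step ?va // -mulrBr /w -/o -/(S i); ring.
Qed.

End PoissonOfBusemann.

(** * Finite sums of real numbers *)

Section RealSums.
Context (R : realType).

(** Double counting: each [e] is paid for by an entry containing it, and an entry is charged at most
    the length of its list, as [F] has no repetition. *)
Lemma sum_cover (I : eqType) (F : seq I) (G : I -> R)
    (cover : seq (seq I * R)) : uniq F ->
  (forall p, p \in cover -> 0 <= p.2) ->
  (forall e, e \in F -> exists2 p, p \in cover & e \in p.1 /\ G e <= p.2) ->
  \sum_(e <- F) G e <= \sum_(p <- cover) (size p.1)%:R * p.2.
Proof.
move=> uF c0 cF.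
apply: (@le_trans _ _ (\sum_(e <- F) \sum_(p <- cover) (e \in p.1)%:R * p.2)).
  rewrite big_seq [leRHS]big_seq; apply: ler_sum => e eF.
  have [p pc [ep Ge]] := cF e eF; rewrite (big_rem p pc) /= ep mul1r.
  apply: le_trans Ge _; rewrite lerDl big_seq sumr_ge0 // => p' /mem_rem p'c.
  by rewrite mulr_ge0 // c0.
rewrite exchange_big /= big_seq [leRHS]big_seq; apply: ler_sum => p pc.
rewrite -mulr_suml ler_wpM2r ?c0 // -natr_sum ler_nat.
rewrite -(@sum1_size _ p.1) -big_mkcond /= sum1_count -size_filter sum1_size.
apply: uniq_leq_size; first exact: filter_uniq.
by move=> e; rewrite mem_filter => /andP[].
Qed.

Lemma sum_unfold_at (f : nat -> R) n k : (k <= n)%N ->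
  \sum_(i < n) f i = \sum_(i < k) f (k - i.+1)%N + \sum_(i < n - k) f (i + k)%N.
Proof.
move=> kn; rewrite -(big_mkord xpredT f) (@big_cat_nat _ _ _ k) //=.
congr (_ + _); first by rewrite big_nat_rev /= big_mkord; apply: eq_bigr.
by rewrite -{1}[k]add0n big_addn big_mkord.
Qed.

Lemma geometric_le (x : R) n : 0 <= x < 1 -> \sum_(i < n) x ^+ i <= (1 - x)^-1.
Proof.
move=> /andP[x0 x1]; rewrite -[leRHS]mul1r ler_pdivlMr ?subr_gt0 //.
have := subrX1 x n; have := exprn_ge0 n x0; nra.
Qed.

End RealSums.

(** * Size of the transform on the segment and on its branches *)

Definition segment_bound (R : realType) (q : nat) : R :=
  (2 * ((q%:R + 1) / (q%:R - 1))) ^+ 2.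

(** The square of [2 r^m (r^k - r^(n-k)) / (q - 1)], with [r = 1 / q], without its nonpositive cross
    term; powers of [r ^+ 2] make the sum over [k] geometric. *)
Definition branch_bound (R : realType) (q n k m : nat) : R :=
  4 * q%:R^-1 ^+ m ^+ 2 * (q%:R^-1 ^+ 2 ^+ k + q%:R^-1 ^+ 2 ^+ (n - k)) /
  (q%:R - 1) ^+ 2.

Section StepSums.
Context (R : realType) {q : nat} {X : regular_tree q}.
Variables (v : nat -> X) (n : nat).
Hypothesis vn : is_segment v n.
Implicit Types (o t u w : X) (i j k m : nat).

Let r : R := q%:R^-1.

Let q2 : 2 <= q%:R :> R.
Proof. by rewrite ler_nat; exact: tree_degree X. Qed.

Definition step_sum o t : R := \sum_(i < n) poisson_step R o t (v i) (v i.+1).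

Let step_sum_at k o t : (k <= n)%N -> step_sum o t =
  \sum_(i < k) poisson_step R o t (v (k - i.+1)%N) (v (k - i.+1).+1) +
  \sum_(i < n - k) poisson_step R o t (v (i + k)%N) (v (i + k).+1).
Proof. exact: (@sum_unfold_at _ (fun i => poisson_step R o t (v i) (v i.+1))). Qed.

Let tail k : R := \sum_(i < k) r ^+ i.+1.

Let tailE k : tail k = (1 - r ^+ k) / (q%:R - 1).
Proof.
have -> : tail k = r * \sum_(i < k) r ^+ i.
  by rewrite mulr_sumr; apply: eq_bigr => i _; rewrite exprS.
have qr : q%:R * r = 1 by rewrite divff //; have := q2; lra.
have := subrX1 r k; set s := \sum_(i < k) _ => rs.
have q1 : q%:R - 1 != 0 :> R by have := q2; lra.
apply: (mulIf q1); rewrite divfK // -[1 - _]opprB rs.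
by rewrite mulrAC mulrBr mulr1 [r * _]mulrC qr; ring.
Qed.

(** Segment edges before [v k] run towards the outward edge, those after it run away, so the two
    sides have opposite signs. *)
Lemma step_sum_outward k m u w : (k <= n)%N -> outward v n k m u w ->
  step_sum u w = r ^+ m * (tail k - tail (n - k)) /\
  step_sum w u = - (r ^+ m * (tail k - tail (n - k))).
Proof.
move=> kn out; have hu i : (i <= n)%N -> dist u (v i) = (m + (i - k) + (k - i))%N.
  by move=> /out[].
have hw i : (i <= n)%N -> dist w (v i) = (m.+1 + (i - k) + (k - i))%N.
  by move=> /out[].
split; rewrite (step_sum_at _ _ kn) mulrBr ?opprB ![r ^+ m * _]mulr_sumr.
  rewrite -sumrN; congr (_ + _); apply: eq_bigr => i _; have := ltn_ord i => lt;
    rewrite /poisson_step !hu ?hw; try lia.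
    by do 2 (case: ifP; first by lia) => _; rewrite -exprD; congr (_ ^+ _); lia.
  case: ifP; last by lia.
  by move=> _; case: ifP; first (by lia); rewrite -exprD => _; congr (- (_ ^+ _)); lia.
rewrite addrC -sumrN; congr (_ + _); apply: eq_bigr => i _; have := ltn_ord i => lt;
  rewrite /poisson_step !hw ?hu; try lia.
  by do 2 (case: ifP; last by lia) => _; rewrite -exprD; congr (_ ^+ _); lia.
case: ifP; first by lia.
by move=> _; case: ifP; last (by lia); rewrite -exprD => _; congr (- (_ ^+ _)); lia.
Qed.

(** All segment edges are coherently oriented, so nothing cancels; the edge itself contributes the
    1. *)
Lemma step_sum_segment j : (j < n)%N ->
  step_sum (v j) (v j.+1) = 1 + tail j + tail (n - j.+1) /\
  step_sum (v j.+1) (v j) = - (1 + tail j + tail (n - j.+1)).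
Proof.
move=> jn; have nj : (n - j)%N = (n - j.+1).+1 by lia.
split; rewrite (step_sum_at _ _ (ltnW jn)) nj big_ord_recl /=.
  rewrite [1 + _]addrC -addrA; congr (_ + (_ + _)).
  - apply: eq_bigr => i _; have lt := ltn_ord i.
    rewrite /poisson_step !vn; try lia.
    by do 2 (case: ifP; first by lia) => _; congr (_ ^+ _); lia.
  - rewrite /poisson_step add0n !vn; try lia.
    do 2 (case: ifP; last by lia) => _.
    by rewrite !subnn.
  - apply: eq_bigr => i _; have lt := ltn_ord i.
    rewrite /poisson_step !vn /bump /=; try lia.
    by do 2 (case: ifP; last by lia) => _; congr (_ ^+ _); lia.
rewrite [1 + _]addrC -addrA !opprD -!sumrN; congr (_ + (_ + _)).
- apply: eq_bigr => i _; have lt := ltn_ord i.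
  rewrite /poisson_step !vn; try lia.
  case: ifP; first by lia.
  by move=> _; case: ifP; last (by lia); move=> _; congr (- (_ ^+ _)); lia.
- rewrite /poisson_step add0n !vn; try lia.
  case: ifP; first by lia.
  move=> _; case: ifP; last by lia.
  by move=> _; rewrite !subnn.
- apply: eq_bigr => i _; have lt := ltn_ord i.
  rewrite /poisson_step !vn /bump /=; try lia.
  case: ifP; last by lia.
  by move=> _; case: ifP; first (by lia); move=> _; congr (- (_ ^+ _)); lia.
Qed.

Let r_ge0 i : 0 <= r ^+ i.
Proof. by rewrite exprn_ge0 // invr_ge0 ler0n. Qed.

Let tail_ge0 k : 0 <= tail k.
Proof. by apply: sumr_ge0. Qed.

Let tail_le k : tail k <= (q%:R - 1)^-1.
Proof.
rewrite tailE -[leRHS]mul1r ler_wpM2r //; first by rewrite invr_ge0; have := q2; lra.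
by have := r_ge0 k; lra.
Qed.

Lemma step_sum_segment_ge j : (j < n)%N -> 4 <= (2 * step_sum (v j) (v j.+1)) ^+ 2.
Proof.
move=> jn; rewrite (step_sum_segment jn).1.
by have := tail_ge0 j; have := tail_ge0 (n - j.+1)%N; nra.
Qed.

Lemma step_sum_segment_le j : (j < n)%N ->
  (2 * step_sum (v j) (v j.+1)) ^+ 2 <= segment_bound R q /\
  (2 * step_sum (v j.+1) (v j)) ^+ 2 <= segment_bound R q.
Proof.
move=> jn; have [-> ->] := step_sum_segment jn; rewrite mulrN sqrrN.
suff : (2 * (1 + tail j + tail (n - j.+1))) ^+ 2 <= segment_bound R q by [].
(* In this form the two tails, each at most [1 / (q - 1)], can be compared directly. *)
have -> : segment_bound R q = (2 * (1 + 2 * (q%:R - 1)^-1)) ^+ 2.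
  by rewrite /segment_bound; field; have := q2; lra.
have := tail_ge0 j; have := tail_ge0 (n - j.+1)%N.
have := tail_le j; have := tail_le (n - j.+1)%N; move=> *.
by rewrite ler_sqr ?nnegrE; lra.
Qed.

Lemma step_sum_outward_le k m u w : (k <= n)%N -> outward v n k m u w ->
  (2 * step_sum u w) ^+ 2 <= branch_bound R q n k m /\
  (2 * step_sum w u) ^+ 2 <= branch_bound R q n k m.
Proof.
move=> kn out; have [-> ->] := step_sum_outward kn out; rewrite mulrN sqrrN.
suff : (2 * (r ^+ m * (tail k - tail (n - k)))) ^+ 2 <= branch_bound R q n k m by [].
rewrite !tailE /branch_bound -/r.
have -> : (2 * (r ^+ m * ((1 - r ^+ k) / (q%:R - 1) - (1 - r ^+ (n - k)) / (q%:R - 1)))) ^+ 2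
   = 4 * r ^+ m ^+ 2 * (r ^+ k - r ^+ (n - k)) ^+ 2 / (q%:R - 1) ^+ 2.
  by field; have := q2; lra.
rewrite ler_wpM2r ?invr_ge0 ?sqr_ge0 // ler_wpM2l //.
  by rewrite mulr_ge0 ?sqr_ge0 //; lra.
rewrite -!exprM ![(2 * _)%N]mulnC !exprM sqrrB.
by have := mulr_ge0 (r_ge0 k) (r_ge0 (n - k)); lra.
Qed.

End StepSums.

(** * Summation over all edges: the upper bound *)

Section UpperBound.
Context (R : realType) {q : nat} {X : regular_tree q}.
Variables (v : nat -> X) (n : nat).
Hypothesis vn : is_segment v n.

Let r : R := q%:R^-1.

Let q2 : 2 <= q%:R :> R.
Proof. by rewrite ler_nat; exact: tree_degree X. Qed.

Definition with_reversals (s : seq (X * X)) := s ++ [seq (e.2, e.1) | e <- s].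

Lemma mem_with_reversals s o t :
  (o, t) \in s \/ (t, o) \in s -> (o, t) \in with_reversals s.
Proof.
rewrite mem_cat => -[->//|ts]; apply/orP; right.
by apply/mapP; exists (t, o).
Qed.

Lemma size_with_reversals s : size (with_reversals s) = (2 * size s)%N.
Proof. by rewrite size_cat size_map mul2n addnn. Qed.

Definition segment_edges := [seq (v j, v j.+1) | j <- iota 0 n].

(** [M] truncates the distance to the segment to keep the cover finite; the final estimate does not
    depend on it. *)
Definition edge_cover M : seq (seq (X * X) * R) :=
  (with_reversals segment_edges, segment_bound R q) ::
  [seq (with_reversals (branch_edges m (v k) (leaves_segment v n k)),
        branch_bound R q n k m) | k <- iota 0 n.+1, m <- iota 0 M].

Lemma edge_coverP o t M : adj o t -> (dist o (v 0%N) < M)%N ->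
  exists2 p, p \in edge_cover M &
    (o, t) \in p.1 /\ (2 * step_sum R v n o t) ^+ 2 <= p.2.
Proof.
move=> ot oM; have [[j jn jE]|[k [m [kn out]]]] := edge_position vn ot.
  exists (with_reversals segment_edges, segment_bound R q); first exact: mem_head.
  have js : (v j, v j.+1) \in segment_edges.
    by apply/mapP; exists j; rewrite // mem_iota.
  have [le1 le2] := step_sum_segment_le R vn jn.
  split; first by apply: mem_with_reversals; case: jE => ->; [left|right].
  by case: jE => -[-> ->].
exists (with_reversals (branch_edges m (v k) (leaves_segment v n k)),
        branch_bound R q n k m).
  rewrite inE; apply/orP; right; apply/allpairsPdep; exists k, m; rewrite !mem_iota.
  split=> //; suff : (m <= dist o (v 0%N))%N by lia.
  by case: out => /(_ 0%N (leq0n _)) [h1 h2]; lia.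
have to : adj t o by rewrite adj_sym.
case: out => out; have [le1 le2] := step_sum_outward_le R kn out; split=> //;
  apply: mem_with_reversals; [left|right]; exact: outward_branch out.
Qed.

Lemma branch_bound_ge0 k m : 0 <= branch_bound R q n k m.
Proof.
have r0 : 0 <= r by rewrite invr_ge0 ler0n.
have q1 : 0 <= (q%:R - 1) ^+ 2 :> R by exact: sqr_ge0.
rewrite /branch_bound -/r divr_ge0 // mulr_ge0 //.
  by rewrite mulr_ge0 // exprn_ge0 // exprn_ge0.
by rewrite addr_ge0 // exprn_ge0 // sqr_ge0.
Qed.

Let qr : q%:R * r = 1.
Proof. by rewrite divff //; have := q2; lra. Qed.

Let r01 : 0 <= r < 1.
Proof.
have := q2; have := qr; have r0 : 0 <= r by rewrite invr_ge0 ler0n.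
by move=> h1 h2; rewrite r0 /=; nra.
Qed.

(** The number of edges grows like [q^m] and the bound decays like [r^(2m)]; what is left is a
    geometric series in [r], with sum at most [q / (q - 1)]. *)
Lemma branch_cost k M : (k <= n)%N ->
  \sum_(m < M) (size (with_reversals (branch_edges m (v k) (leaves_segment v n k))))%:R *
    branch_bound R q n k m <=
  8 * q%:R / (q%:R - 1) ^+ 3 *
    ((q%:R - 1 + (k == 0%N)%:R + (k == n)%:R) * (r ^+ 2 ^+ k + r ^+ 2 ^+ (n - k))).
Proof.
move=> kn; set c : R := _ + (k == n)%:R; set w := r ^+ 2 ^+ k + _.
have w0 : 0 <= w by rewrite addr_ge0 // exprn_ge0 // sqr_ge0.
have cE : (count (leaves_segment v n k) (neighbours (v k)))%:R <= c.
  apply: le_trans (_ : (q.-1 + (k == 0%N) + (k == n))%:R <= _).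
    by rewrite ler_nat count_leaves_segment.
  by rewrite !natrD -subn1 natrB // (ltnW (tree_degree X)).
have c0 : 0 <= c by apply: le_trans cE; rewrite ler0n.
have q1 : 0 < (q%:R - 1) ^+ 2 :> R by rewrite exprn_gt0 //; have := q2; lra.
pose d := 8 * c * w / (q%:R - 1) ^+ 2.
have d0 : 0 <= d by rewrite !mulr_ge0 // invr_ge0 ltW.
apply: (@le_trans _ _ (\sum_(m < M) d * r ^+ m)).
  apply: ler_sum => m _; rewrite size_with_reversals size_branch_edges.
  have -> : d * r ^+ m = (2 * (c * q%:R ^+ m)) * branch_bound R q n k m.
    have qm : q%:R ^+ m * r ^+ m = 1 by rewrite -exprMn qr expr1n.
    transitivity (q%:R ^+ m * r ^+ m * (d * r ^+ m)); first by rewrite qm mul1r.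
    rewrite /branch_bound -/r -/w /d.
    by move: (r ^+ m) (q%:R ^+ m) => x y; field; have := q2; lra.
  rewrite ler_wpM2r ?branch_bound_ge0 // !natrM natrX.
  by rewrite ler_wpM2l // ler_wpM2r // exprn_ge0 // ler0n.
rewrite -mulr_sumr; apply: le_trans (_ : d * (1 - r)^-1 <= _).
  by rewrite ler_wpM2l // geometric_le.
rewrite le_eqVlt; apply/orP; left; apply/eqP.
have -> : (1 - r)^-1 = q%:R / (q%:R - 1).
  have -> : 1 - r = (q%:R - 1) / q%:R by rewrite mulrBl mul1r -/r qr.
  by rewrite invf_div.
by rewrite /d; field; have := q2; lra.
Qed.

(** The term [q - 1] gives two geometric series in [r ^+ 2]; each of the two end corrections adds at
    most 2. *)
Lemma sum_branch_cost :
  \sum_(k < n.+1)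
    (q%:R - 1 + (k == 0%N :> nat)%:R + (k == n :> nat)%:R) *
    (r ^+ 2 ^+ k + r ^+ 2 ^+ (n - k)) <= 2 * q%:R * (2 * q%:R + 1) / (q%:R + 1).
Proof.
pose w k := r ^+ 2 ^+ k + r ^+ 2 ^+ (n - k).
have rr : 0 <= r ^+ 2 < 1.
  by rewrite sqr_ge0 /= expr_lt1 //; case/andP: r01.
have w2 k : w k <= 2.
  have le1 i : r ^+ 2 ^+ i <= 1 by case/andP: rr => *; rewrite exprn_ile1 // ltW.
  by rewrite /w; have := le1 k; have := le1 (n - k)%N; lra.
have delta j : (j <= n)%N -> \sum_(k < n.+1) (k == j :> nat)%:R * w k <= 2.
  move=> jn; rewrite -ltnS in jn; rewrite (bigD1 (Ordinal jn)) //= eqxx mul1r.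
  rewrite big1 ?addr0 // => k kj; case: eqP => [kE|]; last by rewrite mul0r.
  by case/eqP: kj; apply: val_inj.
have sw : \sum_(k < n.+1) w k <= 2 * (1 - r ^+ 2)^-1.
  rewrite big_split /= mulr_natl mulr2n lerD ?geometric_le //.
  rewrite (reindex_inj rev_ord_inj) /=; apply: le_trans (geometric_le n.+1 rr).
  by apply: ler_sum => k _; rewrite subSS subKn // -ltnS.
have -> : \sum_(k < n.+1) (q%:R - 1 + (k == 0%N :> nat)%:R + (k == n :> nat)%:R) *
    (r ^+ 2 ^+ k + r ^+ 2 ^+ (n - k)) =
    (q%:R - 1) * (\sum_(k < n.+1) w k) + \sum_(k < n.+1) (k == 0%N :> nat)%:R * w k +
    \sum_(k < n.+1) (k == n :> nat)%:R * w k.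
  by rewrite mulr_sumr -!big_split /=; apply: eq_bigr => k _; rewrite -!mulrDl.
apply: le_trans (_ : (q%:R - 1) * (2 * (1 - r ^+ 2)^-1) + 2 + 2 <= _).
  by rewrite !lerD ?delta // ler_wpM2l //; have := q2; lra.
have -> : (1 - r ^+ 2)^-1 = q%:R ^+ 2 / ((q%:R - 1) * (q%:R + 1)).
  have -> : 1 - r ^+ 2 = ((q%:R - 1) * (q%:R + 1)) / q%:R ^+ 2.
    by rewrite /r; field; have := q2; lra.
  by rewrite invf_div.
rewrite ler_pdivlMr; last by have := q2; lra.
have -> : ((q%:R - 1) * (2 * (q%:R ^+ 2 / ((q%:R - 1) * (q%:R + 1)))) + 2 + 2) * (q%:R + 1)
    = 2 * q%:R ^+ 2 + 4 * (q%:R + 1) :> R.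
  by field; have := q2; lra.
(* The difference of the two sides is [2 (q - 2) (q + 1)], nonnegative because [q] is at least 2. *)
by have := q2; nra.
Qed.

Lemma step_sum_upper (F : seq (X * X)) : uniq F ->
  (forall e, e \in F -> adj e.1 e.2) ->
  \sum_(e <- F) (2 * step_sum R v n e.1 e.2) ^+ 2 <=
  8 * (q%:R + 1) ^+ 2 / (q%:R - 1) ^+ 2 * n%:R +
  16 * q%:R ^+ 2 * (2 * q%:R + 1) / ((q%:R - 1) ^+ 3 * (q%:R + 1)).
Proof.
move=> uF aF; pose M := (\max_(e <- F) dist e.1 (v 0%N)).+1.
apply: le_trans (@sum_cover _ _ _ _ (edge_cover M) uF _ _) _.
- move=> p; rewrite inE => /orP[/eqP->|]; first exact: sqr_ge0.
  by move=> /allpairsPdep[k [m [_ _ ->]]]; exact: branch_bound_ge0.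
- move=> [a b] eF; apply: edge_coverP; first exact: aF eF.
  by rewrite /M ltnS (@leq_bigmax_seq _ F xpredT (fun e => dist e.1 (v 0%N)) (a, b)).
rewrite /edge_cover big_cons big_allpairs_dep; apply: lerD.
  rewrite /= size_with_reversals size_map size_iota le_eqVlt; apply/orP; left.
  apply/eqP; rewrite /segment_bound natrM.
  by field; have := q2; lra.
rewrite -[iota 0 n.+1]/(index_iota 0 n.+1) big_mkord.
apply: le_trans (_ : \sum_(k < n.+1) 8 * q%:R / (q%:R - 1) ^+ 3 *
    ((q%:R - 1 + (k == 0%N :> nat)%:R + (k == n :> nat)%:R) *
     (r ^+ 2 ^+ k + r ^+ 2 ^+ (n - k))) <= _).
  apply: ler_sum => k _.
  have -> : iota 0 M = index_iota 0 M by rewrite /index_iota subn0.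
  by rewrite big_mkord; apply: branch_cost; rewrite -ltnS.
rewrite -mulr_sumr; have q1 : 0 < q%:R - 1 :> R by have := q2; lra.
apply: le_trans (ler_wpM2l _ sum_branch_cost) _.
  by rewrite mulr_ge0 ?ler0n // ?mulr_ge0 // invr_ge0 exprn_ge0 // ltW.
rewrite le_eqVlt; apply/orP; left; apply/eqP.
by field; have := q2; lra.
Qed.

End UpperBound.

Theorem theorem2 (R : realType) (q : nat) (hq : (2 <= q)%N)
    (X : regular_tree q)
    (nu : X -> probability (borel_boundary X) R)
    (hnu : forall x : X, is_visual_measure x (nu x)) :
  let C : R := 8 * (q%:R + 1) ^+ 2 / (q%:R - 1) ^+ 2 in
  let K : R :=
    16 * q%:R ^+ 2 * (2 * q%:R + 1) / ((q%:R - 1) ^+ 3 * (q%:R + 1)) in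
  forall x y : X,
    ((4 * (dist x y)%:R)%:E
       <= l2norm_sq (poisson_class nu (busemann_class R x y)))%E /\
    (l2norm_sq (poisson_class nu (busemann_class R x y))
       <= (C * (dist x y)%:R + K)%:E)%E.
Proof.
move=> C K x y; have [v [vn v0 vy]] := geodesic_segment x y.
move: (dist x y) vn vy => n vn vy; rewrite -{}v0 -{}vy {x y}.
have va := segment_adj vn.
pose G (e : edge X) : R := (2 * step_sum R v n (origin e) (target e)) ^+ 2.
have -> : l2norm_sq (poisson_class nu (busemann_class R (v 0%N) (v n))) =
    \esum_(e in setT) (G e)%:E.
  apply: eq_esum => e _; rewrite (poisson_busemann hnu e va); congr (_%:E).
  by rewrite /Normc.normc /= expr0n addr0 sqr_sqrtr ?sqr_ge0.
split.
  (* For the lower bound it suffices to keep the segment edges in their forward orientation: [n]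
     distinct edges, worth at least 4 each. *)
  pose ed (i : 'I_n) : edge X := exist _ (v i, v i.+1) (va i (ltn_ord i)).
  have ed_inj : injective ed.
    move=> i j /(congr1 val)[vij _]; apply: val_inj => /=.
    have := vn i j (ltnW (ltn_ord i)) (ltnW (ltn_ord j)); rewrite vij distxx; lia.
  apply: esum_ge; exists [set` [seq ed i | i <- enum 'I_n]].
    by split=> //; exact: finite_seq.
  have us : uniq [seq ed i | i <- enum 'I_n] by rewrite map_inj_uniq ?enum_uniq.
  rewrite -fsbig_seq // [X in (_ <= X)%E]sumEFin lee_fin big_map big_enum /=.
  apply: le_trans (_ : \sum_(i < n) 4 <= _).
    by rewrite sumr_const card_ord mulr_natr.
  by apply: ler_sum => i _; exact: step_sum_segment_ge.
(* The norm is a supremum over finite sets of edges, which [step_sum_upper] bounds uniformly. *)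
rewrite /esum; apply: ge_ereal_sup => _ [A [finA _] <-].
rewrite fsbig_finite // [X in (X <= _)%E]sumEFin lee_fin.
have := @step_sum_upper R q X v n vn (map val (enum_fset (fset_set A))).
rewrite big_map; apply; first by rewrite map_inj_uniq ?fset_uniq //; exact: val_inj.
by move=> _ /mapP[e _ ->]; exact: (valP e).
Qed.
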